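(* Let $\Omega\subset\mathbb{R}^d$ be a bounded domain (connected open set) with $\partial\Omega=\Gamma_1\cup\Gamma_2$, $\Gamma_1\cap\Gamma_2=\emptyset$ (either of $\Gamma_1,\Gamma_2$ may be empty), let $\vec v$ be a velocity field on $\Omega$ with values in $\mathbb{R}^d$, and let $\varepsilon>0$. Let $\{P_i : 1\le i\le N_I\}\subset\Omega$ and $\{P_k : N_I+1\le k\le N\}\subset\partial\Omega$ be any two fixed sets of distinct internal and boundary collocation points, respectively. Let $X=(C_1,\dots,C_N)$, with $C_j\in\mathbb{R}^d$, be a continuous random vector with probability density $\sigma(X)\in L^1(\mathbb{R}^{dN})$. Let $K_N\in\mathbb{R}^{N\times N}$ be the MultiQuadric Kansa collocation matrix for the convection-diffusion problem with mixed boundary conditions, i.e. the matrix whose entries are $$(K_N)_{ij}=\mathcal{L}\phi_{C_j}(P_i)\quad (1\le i\le N_I,\ 1\le j\le N),\qquad (K_N)_{kj}=\mathcal{B}\phi_{C_j}(P_k)\quad (N_I+1\le k\le N,\ 1\le j\le N),$$ where $\phi_C(P)=\sqrt{1+\varepsilon^2\|P-C\|^2}$, $\mathcal{L}u(P)=\Delta u(P)+\langle\nabla u(P),\vec v(P)\rangle$ for $P\in\Omega$, and $\mathcal{B}u(P)=\chi_{\Gamma_1}(P)u(P)+\chi_{\Gamma_2}(P)\,\partial_\nu u(P)$ for $P\in\partial\Omega$. Then the matrix $K_N$ is almost surely nonsingular, i.e. $\det K_N\neq 0$ with probability $1$.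
   Context: The underlying stationary convection-diffusion problem is $\mathcal{L}u=f$ in $\Omega$, $\mathcal{B}u=g$ on $\partial\Omega$, with $\mathcal{L}$ and $\mathcal{B}$ as in the claim; the right-hand sides $f,g$ do not enter the matrix $K_N$. No restrictive assumption is made on $\Omega$, $\vec v$, $f$, $g$, except for those ensuring well-posedness and sufficient regularity of the solution (for example, that $\Omega$ has a Lipschitz boundary). Notation: $\|\cdot\|$ and $\langle\cdot,\cdot\rangle$ are the Euclidean norm and inner product in $\mathbb{R}^d$; $P=(x_1,\dots,x_d)$; the Laplacian $\Delta=\partial^2_{x_1}+\dots+\partial^2_{x_d}$ and the gradient $\nabla=(\partial_{x_1},\dots,\partial_{x_d})$ act on the variable $P$ (with the center $C$ held fixed); $\chi_S$ is the indicator function of a set $S$; $\partial_\nu u(P)=\langle\nabla u(P),\vec\nu(P)\rangle$ is the normal derivative at a boundary point $P$, with $\vec\nu(P)$ the unit normal vector to $\partial\Omega$ at $P$ (understood to exist at the boundary collocation points lying in $\Gamma_2$, so that $K_N$ is defined). Explicitly, with $\phi(r)=\sqrt{1+(\varepsilon r)^2}$ and $r=\|P-C\|$: $\nabla\phi_C(P)=(P-C)\,\phi'(r)/r$ and $\Delta\phi_C(P)=\phi''(r)+(d-1)\phi'(r)/r$, where $\phi'(r)/r=\varepsilon^2(1+(\varepsilon r)^2)^{-1/2}$ and $\phi''(r)=-\varepsilon^4r^2(1+(\varepsilon r)^2)^{-3/2}+\varepsilon^2(1+(\varepsilon r)^2)^{-1/2}$ (these expressions are used also at $r=0$). *)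

(* Defs.v *)
From HB Require Import structures.
From mathcomp Require Import all_boot all_order all_algebra.
From mathcomp Require Import all_classical all_reals all_analysis.

Set Implicit Arguments.
Unset Strict Implicit.
Unset Printing Implicit Defensive.
Import Order.TTheory GRing.Theory Num.Theory.
Import numFieldNormedType.Exports.
Local Open Scope classical_set_scope.
Local Open Scope ring_scope.

(* The n-fold product of a sigma-finite measure mu, on n.-tuple T with its
   product sigma-algebra: the point mass on the empty tuple for n = 0, then
   the image of mu \x mu^n under (x, t) |-> x :: t. *)
Section cons_measure.
Context (d : measure_display) (T : measurableType d) (R : realType).

Definition tcons n (p : T * n.-tuple T) : n.+1.-tuple T :=
  [tuple of p.1 :: p.2].

Lemma measurable_tcons n : measurable_fun [set: T * n.-tuple T] (@tcons n).
Proof. exact: measurable_cons. Qed.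

Lemma measurable_tcons_preimage n (A : set (n.+1.-tuple T)) :
  measurable A -> measurable (@tcons n @^-1` A).
Proof.
by move=> mA; rewrite -[X in measurable X]setTI; exact: measurable_tcons.
Qed.

Variable mu : {sigma_finite_measure set T -> \bar R}.
Variables (n : nat) (m : {sigma_finite_measure set (n.-tuple T) -> \bar R}).

Definition cons_measure : set (n.+1.-tuple T) -> \bar R :=
  pushforward (mu \x m)%E (@tcons n).

Let cons_measure0 : cons_measure set0 = 0%E.
Proof. by rewrite /cons_measure /pushforward preimage_set0 measure0. Qed.

Let cons_measure_ge0 A : (0 <= cons_measure A)%E.
Proof. by rewrite /cons_measure /pushforward; exact: measure_ge0. Qed.

Let cons_measure_sigma_additive : semi_sigma_additive cons_measure.
Proof.
move=> F mF tF mUF; rewrite /cons_measure /pushforward preimage_bigcup.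
apply: measure_semi_sigma_additive.
- by move=> k; exact: measurable_tcons_preimage.
- apply/trivIsetP => /= i j _ _ ij; rewrite -preimage_setI.
  by move/trivIsetP : tF => /(_ _ _ _ _ ij) ->//; rewrite preimage_set0.
- by rewrite -preimage_bigcup; exact: measurable_tcons_preimage.
Qed.

HB.instance Definition _ := isMeasure.Build _ _ _ cons_measure
  cons_measure0 cons_measure_ge0 cons_measure_sigma_additive.

Let cons_measure_sigma_finite : sigma_finite setT cons_measure.
Proof.
have /sigma_finiteP[F [TF ndF Foo]] := sigma_finiteT mu.
have /sigma_finiteP[G [TG ndG Goo]] := sigma_finiteT m.
pose unc (t : n.+1.-tuple T) : T * n.-tuple T := (thead t, [tuple of behead t]).
have tK : cancel (@tcons n) unc.
  by case=> x t; rewrite /unc /= theadE; congr (_, _); exact: val_inj.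
have munc : measurable_fun setT unc.
  apply: measurable_fun_pair.
    exact: (measurable_tnth ord0).
  exact: measurable_behead.
exists (fun k => unc @^-1` (F k `*` G k)) => [|k].
  apply/esym/seteqP; split=> // t _.
  have [k _ Fk] : (\bigcup_k F k) (unc t).1 by rewrite -TF.
  have [l _ Gl] : (\bigcup_k G k) (unc t).2 by rewrite -TG.
  exists (maxn k l) => //; split.
    by move: Fk; apply/subsetPset/ndF/leq_maxl.
  by move: Gl; apply/subsetPset/ndG/leq_maxr.
have [mFk Fkoo] := Foo k; have [mGk Gkoo] := Goo k.
have mFG : measurable (F k `*` G k) by exact: measurableX.
split; first by rewrite -[X in measurable X]setTI; exact: munc.
rewrite /cons_measure /pushforward -comp_preimage.
rewrite (_ : unc \o _ = id); last by apply/funext => p /=; rewrite tK.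
by rewrite preimage_id product_measure1E// lte_mul_pinfty// ge0_fin_numE.
Qed.

HB.instance Definition _ := Measure_isSigmaFinite.Build _ _ _ cons_measure
  cons_measure_sigma_finite.

End cons_measure.

Section power_measure.
Context (d : measure_display) (T : measurableType d) (R : realType).
Variable mu : {sigma_finite_measure set T -> \bar R}.

Fixpoint power_measure n : {sigma_finite_measure set (n.-tuple T) -> \bar R} :=
  match n with
  | 0 => dirac ([tuple] : 0.-tuple T)
  | n'.+1 => cons_measure mu (power_measure n')
  end.

Lemma power_measure_box n (A : 'I_n -> set T) :
  (forall i, measurable (A i)) ->
  power_measure n [set t | forall i, A i (tnth t i)] = (\prod_(i < n) mu (A i))%E.
Proof.
elim: n A => [|n IHn] A mA /=.
  by rewrite big_ord0 diracE mem_set//; case.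
rewrite big_ord_recl -IHn; last by move=> i.
rewrite -product_measure1E//; last first.
  rewrite (_ : [set _ | _] =
      \bigcap_(i in [set: 'I_n]) (@tnth n T ^~ i @^-1` A (lift ord0 i))).
    apply: fin_bigcap_measurable => // i _.
    by rewrite -[X in measurable X]setTI; exact: measurable_tnth.
  by apply/seteqP; split => t /= H i; [move=> _|]; exact: H.
rewrite /cons_measure /pushforward; congr (_ _).
apply/seteqP; split => -[x t] /=.
  move=> H; split; first by have := H ord0.
  by move=> i; have := H (lift ord0 i); rewrite /tcons tnthS.
move=> [Hx Ht] i; case: (unliftP ord0 i) => [j|] ->//.
by rewrite /tcons tnthS.
Qed.

End power_measure.

(* R^d as d.-tuple R with its Borel sigma-algebra. *)
Definition lebesgue_Rn (R : realType) (d : nat) :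
    {sigma_finite_measure set (d.-tuple (measurableTypeR R)) -> \bar R} :=
  power_measure (@lebesgue_measure R) d.

(* R^(dN), read as (R^d)^N. *)
Definition lebesgue_RnN (R : realType) (d N : nat) :
    {sigma_finite_measure set (N.-tuple (d.-tuple (measurableTypeR R)))
     -> \bar R} :=
  power_measure (lebesgue_Rn R d) N.

Section random_vector.
Context (dsp dsp' : measure_display) (T : measurableType dsp)
  (U : measurableType dsp') (R : realType).
Variables (Pr : probability T R) (mu : {measure set U -> \bar R}).

Definition has_density (X : {RV Pr >-> U}) (sigma : U -> R) : Prop :=
  [/\ mu.-integrable setT (EFin \o sigma),
      {ae mu, forall x, (0 <= sigma x)%R} &
      forall A, measurable A ->
        distribution Pr X A = \int[mu]_(x in A) (sigma x)%:E]%E.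

End random_vector.

Section euclidean.
Context (R : realType) (d : nat).
Implicit Types (x y P C : 'rV[R]_d) (u : 'rV[R]_d -> R) (S : set 'rV[R]_d).

Definition dot x y : R := \sum_i x ord0 i * y ord0 i.

Definition enorm x : R := Num.sqrt (dot x x).

Definition partial (i : 'I_d) u : 'rV[R]_d -> R :=
  fun P => 'D_(delta_mx ord0 i) (u : 'rV[R]_d -> R^o) P.

Definition gradient u P : 'rV[R]_d := \row_i partial i u P.

Definition laplacian u P : R := \sum_i partial i (partial i u) P.

Definition boundary S : set 'rV[R]_d := closure S `\` S°.

(* Bouligand's contingent cone. *)
Definition tangent_cone S P : set 'rV[R]_d :=
  [set w | exists (t : nat -> R) (y : nat -> 'rV[R]_d),
     [/\ forall n, 0 < t n, forall n, S (y n),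
         y @ \oo --> P & (fun n => t n *: (y n - P)) @ \oo --> w]].

(* n is a unit normal vector to the hypersurface S at P: the tangent cone of S
   at P is the hyperplane orthogonal to n. This determines n up to its sign:
   either orientation is allowed. *)
Definition unit_normal S P (n : 'rV[R]_d) : Prop :=
  enorm n = 1 /\ tangent_cone S P = [set w | dot w n = 0].

Definition multiquadric (eps : R) C P : R :=
  Num.sqrt (1 + eps ^+ 2 * enorm (P - C) ^+ 2).

Definition convection_diffusion (v : 'rV[R]_d -> 'rV[R]_d) u P : R :=
  laplacian u P + dot (gradient u P) (v P).

Definition normal_derivative (nu : 'rV[R]_d -> 'rV[R]_d) u P : R :=
  dot (gradient u P) (nu P).

Definition mixed_boundary (G1 G2 : set 'rV[R]_d) (nu : 'rV[R]_d -> 'rV[R]_d)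
    u P : R :=
  \1_G1 P * u P + \1_G2 P * normal_derivative nu u P.

(* The first NI collocation points are the internal ones. *)
Definition kansa_matrix (eps : R) (v : 'rV[R]_d -> 'rV[R]_d)
    (G1 G2 : set 'rV[R]_d) (nu : 'rV[R]_d -> 'rV[R]_d)
    (NI N : nat) (P C : 'I_N -> 'rV[R]_d) : 'M[R]_N :=
  \matrix_(i < N, j < N)
    if (i < NI)%N then convection_diffusion v (multiquadric eps (C j)) (P i)
    else mixed_boundary G1 G2 nu (multiquadric eps (C j)) (P i).

Definition row_of_tuple (t : d.-tuple R) : 'rV[R]_d := \row_i tnth t i.

End euclidean.

(* Main.v *)
(* Every row of K_N has, as a function of the center C, the form
   (alpha + (beta + <P_i - C, w>) s_i^2 + gamma s_i^4) / s_i^3 with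
   s_i = sqrt(1 + eps^2 |P_i - C|^2) and (alpha, gamma, w) <> 0. Fix all
   coordinates of C but the first one, x. Then s_i = eps sqrt(q_i(x)) with q_i
   a quadratic polynomial without real roots, and for almost all values of the
   frozen coordinates the q_i are pairwise distinct and the numerators are
   nonzero polynomials in x. Since the square roots of distinct irreducible
   quadratics are linearly independent over R(x), a nontrivial linear
   combination of the rows has finitely many zeros on almost every line, hence
   a null zero set by Fubini. Expanding det K_N along one column, whose
   cofactors depend only on the other centers, gives the result by induction
   on N. *)
Require Import Defs.
From HB Require Import structures.
From mathcomp Require Import all_boot all_order all_algebra.
From mathcomp Require Import all_classical all_reals all_analysis.
From mathcomp Require Import measurable_realfun.
From mathcomp Require Import zify ring lra.

Set Implicit Arguments.
Unset Strict Implicit.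
Unset Printing Implicit Defensive.
Import Order.TTheory GRing.Theory Num.Theory.
Import numFieldNormedType.Exports.
Local Open Scope classical_set_scope.
Local Open Scope ring_scope.

(** * Linear independence over the polynomials of square roots of distinct irreducible
    polynomials *)

Section square_root_extensions.
Variable R : rcfType.
Implicit Types (p q : {poly R}) (qs : seq {poly R}) (f g : R -> R).

(** Nonnegativity makes [Num.sqrt q.[x]] square to [q.[x]] at every [x]; monicity makes distinct
    irreducibles coprime. *)
Definition positive_irreducible q : Prop :=
  [/\ q \is monic, irreducible_poly q & forall x, 0 <= q.[x]].

(* The ring of functions generated over the polynomials by the [Num.sqrt q.[x]],
   q in qs. *)
Fixpoint sqrt_ext qs : (R -> R) -> Prop :=
  match qs with
  | [::] => fun f => exists p, forall x, f x = p.[x]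
  | q :: qs' => fun f => exists g h,
      [/\ sqrt_ext qs' g, sqrt_ext qs' h &
          forall x, f x = g x + h x * Num.sqrt q.[x]]
  end.

Lemma sqrt_ext_poly qs p : sqrt_ext qs (fun x => p.[x]).
Proof.
elim: qs p => [|q qs IH] p /=; first by exists p.
exists (fun x => p.[x]), (fun x => (0 : {poly R}).[x]); split=> // x.
by rewrite horner0 mul0r addr0.
Qed.

Lemma sqrt_extW q qs f : sqrt_ext qs f -> sqrt_ext (q :: qs) f.
Proof.
move=> qsf; exists f, (fun x => (0 : {poly R}).[x]); split=> //.
  exact: sqrt_ext_poly.
by move=> x; rewrite horner0 mul0r addr0.
Qed.

Lemma sqrt_ext_root q qs f : sqrt_ext qs f ->
  sqrt_ext (q :: qs) (fun x => f x * Num.sqrt q.[x]).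
Proof.
move=> qsf; exists (fun x => (0 : {poly R}).[x]), f; split=> //.
  exact: sqrt_ext_poly.
by move=> x; rewrite horner0 add0r.
Qed.

Lemma sqrt_extD qs f g : sqrt_ext qs f -> sqrt_ext qs g ->
  sqrt_ext qs (fun x => f x + g x).
Proof.
elim: qs f g => [|q qs IH] f g /=.
  by move=> [a fa] [b gb]; exists (a + b) => x; rewrite fa gb hornerD.
move=> [a [b [Fa Fb fE]]] [a' [b' [Fa' Fb' gE]]].
exists (fun x => a x + a' x), (fun x => b x + b' x); split; [exact: IH..|].
by move=> x; rewrite fE gE; ring.
Qed.

Lemma sqrt_extM qs f g : (forall q, q \in qs -> positive_irreducible q) ->
  sqrt_ext qs f -> sqrt_ext qs g -> sqrt_ext qs (fun x => f x * g x).
Proof.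
elim: qs f g => [|q qs IH] f g qs_irr /=.
  by move=> [a fa] [b gb]; exists (a * b) => x; rewrite fa gb hornerM.
have [_ _ q_ge0] := qs_irr q (mem_head _ _).
have IHM u w : sqrt_ext qs u -> sqrt_ext qs w -> sqrt_ext qs (fun x => u x * w x).
  by apply: IH => r rqs; apply: qs_irr; rewrite inE rqs orbT.
move=> [a [b [Fa Fb fE]]] [a' [b' [Fa' Fb' gE]]].
exists (fun x => a x * a' x + b x * b' x * q.[x]),
  (fun x => a x * b' x + b x * a' x); split.
- apply: sqrt_extD; first exact: IHM.
  by apply: (IHM); [exact: IHM | exact: sqrt_ext_poly].
- by apply: sqrt_extD; exact: IHM.
- move=> x; rewrite fE gE; have := sqr_sqrtr (q_ge0 x).
  by set s := Num.sqrt _ => <-; ring.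
Qed.

Lemma sqrt_extZ qs f p : (forall q, q \in qs -> positive_irreducible q) ->
  sqrt_ext qs f -> sqrt_ext qs (fun x => p.[x] * f x).
Proof. by move=> qs_irr Ff; apply: sqrt_extM => //; exact: sqrt_ext_poly. Qed.

Lemma exists_notin (s : seq R) : exists x, x \notin s.
Proof.
(* This witness exceeds the absolute value of every entry of [s]. *)
exists (1 + \sum_(y <- s) `|y|); apply/negP => xs.
have : \sum_(y <- s) `|y| < 1 + \sum_(y <- s) `|y| by lra.
apply/negP; rewrite -leNgt.
set S := \sum_(y <- s) _ in xs *.
rewrite [leRHS](big_rem _ xs)/=; apply: le_trans (ler_norm _) _.
by rewrite lerDl sumr_ge0.
Qed.

Definition finite_zeros f := exists s : seq R, forall x, f x = 0 -> x \in s.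

Lemma poly_finite_zeros p : p != 0 -> finite_zeros (fun x => p.[x]).
Proof.
have [n] := ubnP (size p); elim: n p => // n IH p pn p0.
have [[x /eqP px]|/forallNP noroot] := pselect (exists x, p.[x] = 0); last first.
  by exists [::] => x /noroot.
have /factor_theorem[r pE] : root p x by [].
have r0 : r != 0 by apply: contra_neq p0 => r0; rewrite pE r0 mul0r.
have [|//|s sP] := IH r.
  by move: pn; rewrite pE size_Mmonic ?monicXsubC// size_XsubC addn2 ltnS.
exists (x :: s) => y /eqP; rewrite pE hornerM hornerXsubC mulf_eq0 inE.
by case/orP => [/eqP/sP->|]; rewrite ?orbT// subr_eq0 => ->.
Qed.

Lemma poly_fun_eq p q : (forall x, p.[x] = q.[x]) -> p = q.
Proof.
move=> pq; apply/eqP; rewrite -subr_eq0; apply/negPn/negP.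
move=> /poly_finite_zeros[s sP].
have [x /negP] := exists_notin s; apply; apply: sP.
by rewrite hornerD hornerN pq subrr.
Qed.

Lemma irreducible_dvd_sqr q p : irreducible_poly q -> q %| p ^+ 2 -> q %| p.
Proof.
move=> q_irr; apply: contraTT; rewrite -!irreducible_poly_coprime//.
exact: coprimep_expr.
Qed.

(* Infinite descent on the size of b. *)
Lemma no_sqr_quotient q r (a b : {poly R}) : irreducible_poly q -> coprimep q r ->
  a ^+ 2 = b ^+ 2 * (q * r) -> b = 0.
Proof.
move=> q_irr qr; have q0 := irredp_neq0 q_irr.
have [n] := ubnP (size b); elim: n a b => // n IH a b bn abE.
have [//|b0] := eqVneq b 0.
have /(irreducible_dvd_sqr q_irr)/dvdpP[a' aE] : q %| a ^+ 2.
  by rewrite abE mulrCA dvdp_mulr.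
have a'bE : a' ^+ 2 * q = b ^+ 2 * r.
  by apply: (mulfI q0); transitivity (a ^+ 2); [rewrite aE | rewrite abE]; ring.
have /(irreducible_dvd_sqr q_irr)/dvdpP[b' bE] : q %| b ^+ 2.
  by rewrite -(Gauss_dvdpl _ qr) -a'bE dvdp_mull.
have b'0 : b' != 0 by apply: contra_neq b0 => b'0; rewrite bE b'0 mul0r.
suff b'eq0 : b' = 0 by rewrite b'eq0 eqxx in b'0.
apply: (IH a').
  have : (1 < size q)%N by case: q_irr.
  move: bn; rewrite bE size_mul//.
  by move: (size q) (size b') => [|[|j]] i //; rewrite !addnS/=; lia.
by apply: (mulfI q0); rewrite -[LHS]mulrC a'bE bE; ring.
Qed.

(** A monic irreducible that divides another one equals it, so [q] is coprime to each factor. *)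
Lemma coprimep_prod_irreducible q rs : positive_irreducible q ->
  (forall r, r \in rs -> positive_irreducible r) -> q \notin rs ->
  coprimep q (\prod_(r <- rs) r).
Proof.
move=> [qm qi _]; elim: rs => [|r rs IH] rs_irr; first by rewrite big_nil coprimep1.
rewrite inE negb_or big_cons => /andP[qr qrs]; rewrite coprimepMr IH ?andbT//; last first.
  by move=> s srs; apply: rs_irr; rewrite inE srs orbT.
have [rm ri _] := rs_irr r (mem_head _ _).
rewrite irreducible_poly_coprime//; apply: contra qr => qdr.
by rewrite -eqp_monic//; apply: (ri.2) => //; have [/gtn_eqF->] := qi.
Qed.

Definition null f := forall x : R, f x = 0.

(** Functions on [R] have zero divisors. If both zero sets are finite, however, some point avoids
    them both, and the product is nonzero there. *)
Lemma null_mul f g : null f \/ finite_zeros f -> null g \/ finite_zeros g ->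
  null (fun x => f x * g x) -> null f \/ null g.
Proof.
move=> [|[s fs]]; first by left.
move=> [|[t gt]]; first by right.
move=> fg; have [x /negP] := exists_notin (s ++ t); case.
have /eqP := fg x; rewrite mem_cat mulf_eq0.
by case/orP => /eqP => [/fs|/gt] ->; rewrite ?orbT.
Qed.

(* The two claims need each other: a zero of [g + h sqrt q] is a zero of its
   norm [g^2 - h^2 q], which does not vanish identically because [q] is not a
   square in the extension by the other square roots. *)
Lemma sqrt_ext_dichotomy qs :
    uniq qs -> (forall q, q \in qs -> positive_irreducible q) ->
  (forall f, sqrt_ext qs f -> null f \/ finite_zeros f) /\
  (forall r rs f g, uniq (r :: rs) ->
    (forall q, q \in r :: rs -> positive_irreducible q /\ q \notin qs) ->
    sqrt_ext qs f -> sqrt_ext qs g ->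
    (forall x, f x ^+ 2 = g x ^+ 2 * (\prod_(q <- r :: rs) q).[x]) -> null g).
Proof.
elim: qs => [|q qs IH] /=.
  move=> _ _; split=> [f [p fE]|r rs f g].
    have [p0|/poly_finite_zeros[s sP]] := eqVneq p 0.
      by left=> x; rewrite fE p0 horner0.
    by right; exists s => x; rewrite fE => /sP.
  move=> /andP[rrs urs] irr [a fE] [b gE] fg x.
  rewrite gE (_ : b = 0) ?horner0//.
  have [[rm ri rp] _] := irr r (mem_head _ _).
  apply: (@no_sqr_quotient r (\prod_(q <- rs) q) a) => //.
    apply: coprimep_prod_irreducible => // q qrs.
    by have [|//] := irr q; rewrite inE qrs orbT.
  apply: poly_fun_eq => y; rewrite [RHS]hornerM !horner_exp -gE -fE fg.
  by rewrite big_cons.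
move=> /andP[qqs uqs] irr.
have irr' r : r \in qs -> positive_irreducible r.
  by move=> rqs; apply: irr; rewrite inE rqs orbT.
have {IH} [IH1 IH2] := IH uqs irr'.
have q_irr := irr q (mem_head _ _).
have [_ _ q_ge0] := q_irr.
(* The non-square claim for the single polynomial [q]: it makes the decomposition [g + h sqrt q]
   unique. *)
have q_nsq f g : sqrt_ext qs f -> sqrt_ext qs g ->
    (forall x, f x ^+ 2 = g x ^+ 2 * q.[x]) -> null f /\ null g.
  move=> Ff Fg fg; suff g0 : null g.
    by split=> // x; apply/eqP; rewrite -sqrf_eq0 fg g0 expr0n mul0r.
  apply: (IH2 q [::] f g) => // [r|x]; last by rewrite big_seq1.
  by rewrite inE => /eqP->.
have sqK x : Num.sqrt q.[x] ^+ 2 = q.[x] by rewrite sqr_sqrtr.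
have FM f g := @sqrt_extM qs f g irr'.
have FZ f p := @sqrt_extZ qs f p irr'.
split=> [f [g [h [Fg Fh fE]]]|r rs f g].
  pose N x := g x ^+ 2 - h x ^+ 2 * q.[x].
  have FN : sqrt_ext qs N.
    rewrite (_ : N = fun x => g x * g x + (- q).[x] * (h x * h x)).
      by apply: sqrt_extD; [exact: FM | apply: FZ; exact: FM].
    by apply/funext => x; rewrite /N hornerN; ring.
  have [N0|[s sP]] := IH1 N FN.
    left=> x; have [|g0 h0] := q_nsq _ _ Fg Fh; last by rewrite fE g0 h0 mul0r addr0.
    by move=> y; apply/eqP; rewrite -subr_eq0; apply/eqP/N0.
  right; exists s => x; rewrite fE => fx; apply: sP; rewrite /N -[q.[x]]sqK.
  by have -> : g x = - (h x * Num.sqrt q.[x]); [lra | ring].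
move=> urrs irrs [a [b [Fa Fb fE]]] [z [w [Fz Fw gE]]] fg.
set m := \prod_(_ <- _) _ in fg.
have irrs1 s : s \in r :: rs -> positive_irreducible s /\ s \notin qs.
  by move=> /irrs[? ]; rewrite inE negb_or => /andP[].
have m_nsq f' g' : sqrt_ext qs f' -> sqrt_ext qs g' ->
    (forall x, f' x ^+ 2 = g' x ^+ 2 * m.[x]) -> null g'.
  exact: IH2.
(* Here the list grows from [r :: rs] to [q :: r :: rs]; this is why the second claim is stated for
   products and not for a single polynomial. *)
have qm_nsq f' g' : sqrt_ext qs f' -> sqrt_ext qs g' ->
    (forall x, f' x ^+ 2 = g' x ^+ 2 * (q * m).[x]) -> null g'.
  move=> Ff' Fg' E; apply: (IH2 q (r :: rs) f' g') => //.
  - apply/andP; split=> //; apply/negP => /irrs[_].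
    by rewrite mem_head.
  - by move=> s; rewrite inE => /predU1P[->|/irrs1].
  - by move=> x; rewrite big_cons.
(* [x + y sqrt q] is [f] times the conjugate of [g], and [n] the norm of [g]. *)
pose x t := a t * z t - b t * w t * q.[t].
pose y t := b t * z t - a t * w t.
pose n t := z t ^+ 2 - w t ^+ 2 * q.[t].
have Fx : sqrt_ext qs x.
  rewrite (_ : x = fun t => a t * z t + (- q).[t] * (b t * w t)).
    by apply: sqrt_extD; [exact: FM | apply: FZ; exact: FM].
  by apply/funext => t; rewrite /x hornerN; ring.
have Fy : sqrt_ext qs y.
  rewrite (_ : y = fun t => b t * z t + (- 1 : {poly R}).[t] * (a t * w t)).
    by apply: sqrt_extD; [exact: FM | apply: FZ; exact: FM].
  by apply/funext => t; rewrite /y hornerN hornerC; ring.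
have Fn : sqrt_ext qs n.
  rewrite (_ : n = fun t => z t * z t + (- q).[t] * (w t * w t)).
    by apply: sqrt_extD; [exact: FM | apply: FZ; exact: FM].
  by apply/funext => t; rewrite /n hornerN; ring.
(* This is [fg] multiplied by the square of the conjugate of [g], sorted into a part free of
   [sqrt q] and a multiple of [sqrt q]. *)
have xyn t : x t ^+ 2 + y t ^+ 2 * q.[t] - n t ^+ 2 * m.[t]
    + 2 * (x t * y t) * Num.sqrt q.[t] = 0.
  have := fg t; rewrite fE gE /n /x /y; have := sqK t.
  set s := Num.sqrt _ => <- fgt; apply/eqP; rewrite addrAC subr_eq0; apply/eqP.
  transitivity ((a t + b t * s) ^+ 2 * (z t - w t * s) ^+ 2); first by ring.
  by rewrite fgt; ring.
have FA : sqrt_ext qs (fun t => x t ^+ 2 + y t ^+ 2 * q.[t] - n t ^+ 2 * m.[t]).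
  rewrite (_ : (fun t => _) = fun t => x t * x t + q.[t] * (y t * y t)
      + (- m).[t] * (n t * n t)); last by apply/funext => t; rewrite hornerN; ring.
  by apply: sqrt_extD; [apply: sqrt_extD|];
    [exact: FM | apply: FZ; exact: FM..].
have FB : sqrt_ext qs (fun t => 2 * (x t * y t)).
  rewrite (_ : (fun t => _) = fun t => (2%:P : {poly R}).[t] * (x t * y t)).
    by apply: (FZ); exact: FM.
  by apply/funext => t; rewrite hornerC.
(* Both parts vanish: [A + B sqrt q = 0] gives [A^2 = B^2 q]. *)
have [|A0 B0] := q_nsq _ _ FA FB.
  move=> t; rewrite -[in RHS]sqK -exprMn; apply/eqP.
  by rewrite eqf_sqr -addr_eq0 xyn eqxx orbT.
have n0 : null n.
  (* [B0] says that [x y] vanishes. If [x] is null, then [y^2 q = n^2 m], hence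
     [(q y)^2 = n^2 (q m)]; if [y] is null, then [x^2 = n^2 m]. Either way [n] is null. *)
  have [|x0|y0] := null_mul (IH1 _ Fx) (IH1 _ Fy).
  - by move=> t; have := B0 t; lra.
  - apply: (qm_nsq (fun t => q.[t] * y t)) => //; first exact: FZ.
    move=> t; have := A0 t; rewrite x0 hornerM.
    by move/eqP; rewrite subr_eq0 => /eqP E; transitivity (q.[t] * (y t ^+ 2 * q.[t]));
      [ring | rewrite -[y t ^+ 2 * _]add0r -[0](expr0n R 2) E; ring].
  - apply: (m_nsq x) => // t; have := A0 t; rewrite y0 => /eqP.
    by rewrite subr_eq0 expr0n mul0r addr0 => /eqP.
have [|z0 w0] := q_nsq z w Fz Fw.
  by move=> t; apply/eqP; rewrite -subr_eq0; apply/eqP/n0.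
by move=> t; rewrite gE z0 w0 mul0r addr0.
Qed.

Lemma sqrt_ext_sum (I : Type) (s : seq I) (p q : I -> {poly R}) :
  sqrt_ext (map q s) (fun x => \sum_(i <- s) (p i).[x] * Num.sqrt (q i).[x]).
Proof.
elim: s => [|i s IH]; first by exists 0 => x; rewrite big_nil horner0.
under eq_fun do rewrite big_cons.
apply: sqrt_extD; last exact: sqrt_extW.
by apply: sqrt_ext_root; exact: sqrt_ext_poly.
Qed.

(** Moving the head term to the other side and squaring makes [(p i)^2 (q i)] the square of an
    element of the extension by the remaining roots, which forces [p i = 0]; then induct on the
    tail. *)
Lemma sqrt_sum_null (I : eqType) (s : seq I) (p q : I -> {poly R}) :
    uniq (map q s) -> (forall i, positive_irreducible (q i)) ->
    null (fun x => \sum_(i <- s) (p i).[x] * Num.sqrt (q i).[x]) ->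
  forall i, i \in s -> p i = 0.
Proof.
move=> + q_irr; elim: s => // i s IH /andP[qis us] c0.
have irr' r : r \in map q s -> positive_irreducible r by move=> /mapP[j _ ->].
have [_ nsq] := sqrt_ext_dichotomy us irr'; have [_ _ q_ge0] := q_irr i.
have pi0 : null (fun x => (p i).[x]).
  apply: (nsq (q i) [::] (fun x => \sum_(j <- s) (p j).[x] * Num.sqrt (q j).[x])) => //.
  - by move=> r; rewrite inE => /eqP->.
  - exact: sqrt_ext_sum.
  - exact: sqrt_ext_poly.
  move=> x; rewrite big_seq1 -[(q i).[x]]sqr_sqrtr// -exprMn; apply/eqP.
  rewrite eqf_sqr -addr_eq0 addrC; have := c0 x; rewrite big_cons => ->.
  by rewrite eqxx orbT.
have piE : p i = 0 by apply: poly_fun_eq => x; rewrite pi0 horner0.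
move=> j; rewrite inE => /predU1P[->//|]; apply: IH => // x.
by have := c0 x; rewrite big_cons piE horner0 mul0r add0r.
Qed.

Lemma sqrt_sum_finite_zeros (I : finType) (p q : I -> {poly R}) :
    injective q -> (forall i, positive_irreducible (q i)) ->
    (exists i, p i != 0) ->
  finite_zeros (fun x => \sum_i (p i).[x] * Num.sqrt (q i).[x]).
Proof.
move=> q_inj irr [i pi].
have uq : uniq (map q (index_enum I)) by rewrite map_inj_uniq// index_enum_uniq.
have irr' r : r \in map q (index_enum I) -> positive_irreducible r.
  by move=> /mapP[j _ ->].
have [zeros _] := sqrt_ext_dichotomy uq irr'.
have [f0|//] := zeros _ (sqrt_ext_sum (index_enum I) p q).
by rewrite (sqrt_sum_null uq irr f0 (mem_index_enum i)) eqxx in pi.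
Qed.

Lemma positive_irreducible_quad (a b : R) : 0 < b ->
  positive_irreducible (('X - a%:P) ^+ 2 + b%:P).
Proof.
move=> b0; have q_gt0 x : 0 < (('X - a%:P) ^+ 2 + b%:P).[x].
  by rewrite !hornerE ltr_wpDl// sqr_ge0.
have sz : size (('X - a%:P) ^+ 2 + b%:P) = 3.
  by rewrite size_polyDl size_exp_XsubC// (leq_ltn_trans (size_polyC_leq1 _)).
split.
- rewrite monicE lead_coefDl ?size_exp_XsubC ?(leq_ltn_trans (size_polyC_leq1 _))//.
  by rewrite -monicE monic_exp// monicXsubC.
- apply: cubic_irreducible; first by rewrite sz.
  by move=> x; rewrite rootE gt_eqF.
- by move=> x; exact: ltW.
Qed.

End square_root_extensions.

(** * Null sets of power measures, and determinants whose columns depend on separate variables *)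

Section power_measure_null.
Context (dsp : measure_display) (T : measurableType dsp) (R : realType).
Variable mu : {sigma_finite_measure set T -> \bar R}.

Lemma product_measure_null (d' : measure_display) (U : measurableType d')
    (m : {sigma_finite_measure set U -> \bar R}) (A : set (T * U)) :
  measurable A -> {ae m, forall y, mu (ysection A y) = 0%E} ->
  (mu \x m)%E A = 0%E.
Proof.
move=> mA A0.
(* The product is replaced by [\x^], which integrates the [mu]-measure of the [ysection]s against
   [m]. *)
rewrite (@product_measure_unique _ _ _ _ _ mu m (mu \x^ m)%E)//; last first.
  by move=> B C mB mC; exact: product_measure2E.
rewrite /product_measure2 -[RHS](@integral0 _ _ _ m setT).
apply: ge0_ae_eq_integral => //.
- exact: measurable_fun_ysection.
- by apply: filterS A0 => y /= ->.
Qed.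

(** Fubini with all entries frozen except the first. It serves both for the centers (entries in
    [R^d]) and for the coordinates of one center. *)
Lemma power_measure_cons_null n (A : set (n.+1.-tuple T)) :
    measurable A ->
    {ae power_measure mu n, forall t, mu [set x | A (tcons (x, t))] = 0%E} ->
  power_measure mu n.+1 A = 0%E.
Proof.
move=> mA A0; rewrite /= /cons_measure /pushforward.
apply: product_measure_null; first exact: measurable_tcons_preimage.
apply: filterS A0 => t; rewrite (_ : ysection _ _ = [set x | A (tcons (x, t))])//.
by apply/seteqP; split=> x /=; rewrite /ysection/= ?inE.
Qed.

Lemma ae_null (d' : measure_display) (U : measurableType d')
    (m : {measure set U -> \bar R}) (A : set U) :
  measurable A -> m A = 0%E -> {ae m, forall x, ~ A x}.
Proof. by move=> mA A0; exists A; split=> // x /= /contrapT. Qed.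

Lemma measurable_zeros (d' : measure_display) (U : measurableType d') (f : U -> R) :
  measurable_fun setT f -> measurable [set x | f x = 0].
Proof.
move=> mf; rewrite (_ : [set x | _] = f @^-1` [set 0])//.
by rewrite -[X in measurable X]setTI; apply: mf => //; exact: measurable_set1.
Qed.

Lemma measurable_det N (F : 'I_N -> T -> R) :
  (forall i, measurable_fun setT (F i)) ->
  measurable_fun setT
    (fun t : N.-tuple T => \det (\matrix_(i, j) F i (tnth t j))).
Proof.
move=> mF; apply: measurable_sum => s; apply: measurable_funM => //.
under eq_fun do under eq_bigr do rewrite mxE.
apply: measurable_prod => i _.
by apply: measurableT_comp => //; exact: measurable_tnth.
Qed.

Lemma det_collocation_null N (F : 'I_N -> T -> R) :
    (forall i, measurable_fun setT (F i)) ->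
    (forall a : 'I_N -> R, (exists i, a i != 0) ->
       mu [set x | \sum_i a i * F i x = 0] = 0%E) ->
  power_measure mu N
    [set t | \det (\matrix_(i < N, j < N) F i (tnth t j)) = 0] = 0%E.
Proof.
elim: N F => [|N IHN] F mF F0.
  rewrite (_ : [set t | _] = set0) ?measure0//.
  by apply/seteqP; split=> t //=; rewrite det_mx00 => /eqP; rewrite oner_eq0.
apply: power_measure_cons_null; first exact: measurable_zeros (measurable_det mF).
(* The functions in the minor obtained by deleting row 0 and column 0. *)
pose F' (i : 'I_N) := F (lift ord0 i).
have minor0 : power_measure mu N
    [set t | \det (\matrix_(i < N, j < N) F' i (tnth t j)) = 0] = 0%E.
  apply: IHN => [i|a [i ai0]]; first exact: mF.
  (* Coefficients for [F'] are extended by 0 at row 0, which turns a combination of [F'] into one of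
     [F]. *)
  pose b i := if unlift ord0 i is Some j then a j else 0.
  have bE x : \sum_i b i * F i x = \sum_i a i * F' i x.
    rewrite big_ord_recl /b unlift_none mul0r add0r.
    by apply: eq_bigr => k _; rewrite liftK.
  rewrite -(F0 b); last by exists (lift ord0 i); rewrite /b liftK.
  by congr (mu _); apply/seteqP; split=> x /=; rewrite bE.
have mF' : measurable_fun setT
    (fun t : N.-tuple T => \det (\matrix_(i, j) F' i (tnth t j))).
  by apply: measurable_det => i; exact: mF.
apply: filterS (ae_null (measurable_zeros mF') minor0) => t /= det0.
(* The cofactors of column 0, free of [x]; the one at row 0 is the minor, nonzero for this [t]. *)
pose a (i : 'I_N.+1) :=
  (-1) ^+ i * \det (\matrix_(k < N, j < N) F (lift i k) (tnth t j)).
have detE x : \det (\matrix_(i < N.+1, j < N.+1) F i (tnth (tcons (x, t)) j)) =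
    \sum_i a i * F i x.
  rewrite (expand_det_col _ ord0); apply: eq_bigr => i _.
  rewrite mxE mulrC /cofactor addn0; congr (_ * \det _ * _).
  by apply/matrixP => k j; rewrite !mxE /tcons tnthS.
rewrite -(F0 a); last by exists ord0; rewrite /a expr0 mul1r; apply/eqP.
by congr (mu _); apply/seteqP; split=> x /=; rewrite detE.
Qed.

End power_measure_null.

(** * Affine hyperplanes are Lebesgue-null *)

Lemma measurable_affine (R : realType) n (w : 'I_n -> R) (c : R) :
  measurable [set t : n.-tuple (measurableTypeR R) | \sum_i w i * tnth t i = c].
Proof.
rewrite (_ : [set t | _] = [set t | \sum_i w i * tnth t i - c = 0]); last first.
  by apply/seteqP; split=> t /= => [->|/subr0_eq//]; rewrite subrr.
apply: measurable_zeros; apply: measurable_funB => //; apply: measurable_sum => i.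
by apply: measurable_funM => //; exact: measurable_tnth.
Qed.

(** Slice along the first coordinate. If [w ord0] is nonzero, every slice is a single point;
    otherwise the equation involves only the tail, and by induction almost every slice is empty. *)
Lemma affine_null (R : realType) n (w : 'I_n -> R) (c : R) :
    (exists i, w i != 0) \/ c != 0 ->
  power_measure (@lebesgue_measure R) n [set t | \sum_i w i * tnth t i = c] = 0%E.
Proof.
elim: n w => [|n IH] w wc.
  rewrite (_ : [set t | _] = set0) ?measure0//.
  apply/seteqP; split=> t //=; rewrite big_ord0 => c0.
  by case: wc => [[[]]//|]; rewrite -c0 eqxx.
apply: power_measure_cons_null; first exact: measurable_affine.
have sumE x (t : n.-tuple R) : \sum_i w i * tnth (tcons (x, t)) i =
    w ord0 * x + \sum_i w (lift ord0 i) * tnth t i.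
  by rewrite big_ord_recl; under eq_bigr do rewrite /tcons tnthS.
have [w0|w0] := eqVneq (w ord0) 0.
  have /ae_null : power_measure (@lebesgue_measure R) n
      [set t | \sum_i w (lift ord0 i) * tnth t i = c] = 0%E.
    apply: IH; case: wc => [[i]|]; last by right.
    by case: (unliftP ord0 i) => [j|] ->; [left; exists j | rewrite w0 eqxx].
  move=> /(_ (measurable_affine _ _)); apply: filterS => t /= tc.
  rewrite (_ : [set x | _] = set0) ?measure0//.
  by apply/seteqP; split=> x //=; rewrite sumE w0 mul0r add0r.
apply: aeW => t.
apply/countable_lebesgue_measure0/finite_set_countable.
set c' := (c - \sum_i w (lift ord0 i) * tnth t i) / w ord0.
apply: (@sub_finite_set _ _ [set c']) => // x /=; rewrite /c'.
by rewrite sumE => <-; rewrite addrK mulrAC divff ?mul1r.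
Qed.

(** * Gradient and Laplacian of the multiquadric *)

Section multiquadric_derivatives.
Context (R : realType) (d : nat).
Implicit Types (x y P C w : 'rV[R]_d) (eps : R).

Lemma dot_ge0 x : 0 <= dot x x.
Proof. by apply: sumr_ge0 => i _; rewrite -expr2 sqr_ge0. Qed.

Lemma multiquadric_sqr eps C P :
  multiquadric eps C P ^+ 2 = 1 + eps ^+ 2 * dot (P - C) (P - C).
Proof.
rewrite /multiquadric /enorm sqr_sqrtr sqr_sqrtr ?dot_ge0//.
by rewrite addr_ge0// mulr_ge0 ?sqr_ge0// dot_ge0.
Qed.

Lemma multiquadric_gt0 eps C P : 0 < multiquadric eps C P.
Proof. by rewrite sqrtr_gt0 ltr_pwDl// mulr_ge0// sqr_ge0. Qed.

Lemma dot_delta x i (h : R) :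
  dot (h *: delta_mx ord0 i + x) (h *: delta_mx ord0 i + x) =
  dot x x + 2 * h * x ord0 i + h ^+ 2.
Proof.
rewrite /dot (bigD1 i)//= [in RHS](bigD1 i)//= !mxE !eqxx mulr1.
rewrite (eq_bigr (fun k => x ord0 k * x ord0 k)); first by ring.
by move=> k /negPf ki; rewrite !mxE ki andbF mulr0 add0r.
Qed.

Lemma partial_line (u : 'rV[R]_d -> R) i P :
  partial i u P = 'D_1 (fun h : R => u (h *: delta_mx ord0 i + P) : R^o) 0.
Proof.
(* Both derivatives are limits of the same difference quotient. *)
apply: (congr1 (fun F : R -> R^o => lim (F @ 0^'))); apply/funext => h /=.
by rewrite addr0 scale0r add0r [h *: 1]mulr1.
Qed.

Lemma is_derive_multiquadric_line eps C P i :
  is_derive (0 : R) 1 (fun h : R => multiquadric eps C (h *: delta_mx ord0 i + P))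
    (eps ^+ 2 * (P - C) ord0 i / multiquadric eps C P).
Proof.
set s := multiquadric eps C P; have s_gt0 : 0 < s := multiquadric_gt0 eps C P.
(* The square of the multiquadric along the line, as a polynomial in [h]. *)
pose p : {poly R} :=
  (s ^+ 2)%:P + (eps ^+ 2)%:P * ((2 * (P - C) ord0 i)%:P * 'X + 'X * 'X).
have p0 : p.[0] = s ^+ 2 by rewrite /p !hornerE /=; ring.
have -> : (fun h : R => multiquadric eps C (h *: delta_mx ord0 i + P)) =
    Num.sqrt \o (fun h => p.[h]).
  apply/funext => h; rewrite /multiquadric /enorm sqr_sqrtr ?dot_ge0//=.
  congr Num.sqrt; rewrite -addrA dot_delta /p multiquadric_sqr !hornerE; ring.
have -> : eps ^+ 2 * (P - C) ord0 i / s = (2 * Num.sqrt p.[0])^-1 * p^`().[0].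
  rewrite p0 sqrtr_sqr gtr0_norm// /p !poly.derivE !hornerE /=.
  by field; rewrite gt_eqF.
have dsqrt : is_derive p.[0] 1 Num.sqrt (2 * Num.sqrt p.[0])^-1.
  by apply: is_derive1_sqrt; rewrite p0 exprn_gt0.
exact: (is_derive1_comp (g := horner p) dsqrt (is_derive_poly p 0)).
Qed.

Lemma partial_multiquadric eps C P i :
  partial i (multiquadric eps C) P = eps ^+ 2 * (P - C) ord0 i / multiquadric eps C P.
Proof.
by rewrite partial_line; have [_ ->] := is_derive_multiquadric_line eps C P i.
Qed.

Lemma partial2_multiquadric eps C P i :
  partial i (partial i (multiquadric eps C)) P =
  eps ^+ 2 / multiquadric eps C P -
  eps ^+ 4 * (P - C) ord0 i ^+ 2 / multiquadric eps C P ^+ 3.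
Proof.
set s := multiquadric eps C P; have s_gt0 : 0 < s := multiquadric_gt0 eps C P.
rewrite (funext (partial_multiquadric eps C ^~ i)) partial_line.
pose l (h : R) := multiquadric eps C (h *: delta_mx ord0 i + P).
have l0 : l 0 = s by rewrite /l scale0r add0r.
pose p : {poly R} := (eps ^+ 2)%:P * ('X + ((P - C) ord0 i)%:P).
have -> : (fun h : R => eps ^+ 2 * (h *: delta_mx ord0 i + P - C) ord0 i / l h) =
    (fun h => p.[h] * (l h)^-1).
  by apply/funext => h; rewrite -addrA /p !hornerE !mxE !eqxx /=; ring.
have dl : is_derive (0 : R) 1 l (eps ^+ 2 * (P - C) ord0 i / s).
  exact: is_derive_multiquadric_line.
have l_neq0 : l 0 != 0 by rewrite l0 gt_eqF.
have [_ ->] := is_deriveM (is_derive_poly p 0) (is_deriveV l_neq0 dl).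
rewrite l0 /p !poly.derivE !hornerE /= /GRing.scale/=.
by field; rewrite gt_eqF.
Qed.

Lemma laplacian_multiquadric eps C P :
  laplacian (multiquadric eps C) P =
  eps ^+ 2 * (1 + (d%:R - 1) * multiquadric eps C P ^+ 2) / multiquadric eps C P ^+ 3.
Proof.
have s_neq0 : multiquadric eps C P != 0 by rewrite gt_eqF ?multiquadric_gt0.
rewrite /laplacian (eq_bigr _ (fun i _ => partial2_multiquadric eps C P i)).
rewrite sumrB sumr_const card_ord -mulr_suml -mulr_sumr.
have -> : \sum_i (P - C) ord0 i ^+ 2 = dot (P - C) (P - C) by [].
have := multiquadric_sqr eps C P.
move: (multiquadric _ _ _) s_neq0 (dot _ _) => s s_neq0 r sE.
(* The squared distance [r] is eliminated in favour of [s]. *)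
have -> : eps ^+ 4 * r = eps ^+ 2 * (s ^+ 2 - 1) by rewrite sE; ring.
by rewrite -mulr_natr; field.
Qed.

Lemma dot_gradient_multiquadric eps C P w :
  dot (gradient (multiquadric eps C) P) w =
  eps ^+ 2 * dot (P - C) w / multiquadric eps C P.
Proof.
rewrite /dot mulr_sumr mulr_suml; apply: eq_bigr => i _.
by rewrite mxE partial_multiquadric; ring.
Qed.

End multiquadric_derivatives.

(** * The matrix rows as functions of the center *)

Section kansa_rows.
Context (R : realType) (eps : R).
Hypothesis eps_gt0 : 0 < eps.

Let s (d : nat) (P C : 'rV[R]_d) := multiquadric eps C P.

(* The common form of the rows: (eps^2, eps^2 (d - 1), 0, eps^2 v) for the
   operator L, (0, 0, 1, 0) on Gamma_1, (0, 0, 0, eps^2 nu) on Gamma_2. *)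
Definition kansa_row d (alpha beta gamma : R) (w P C : 'rV[R]_d) : R :=
  (alpha + (beta + dot (P - C) w) * s P C ^+ 2 + gamma * s P C ^+ 4) / s P C ^+ 3.

Lemma measurable_dot_row d (P w : 'rV[R]_d) : measurable_fun setT
  (fun c : d.-tuple (measurableTypeR R) => dot (P - row_of_tuple c) w).
Proof.
apply: measurable_sum => i; apply: measurable_funM => //.
under eq_fun do rewrite !mxE.
by apply: measurable_funB => //; exact: measurable_tnth.
Qed.

Lemma measurable_multiquadric_row d (P : 'rV[R]_d) : measurable_fun setT
  (fun c : d.-tuple (measurableTypeR R) => s P (row_of_tuple c)).
Proof.
have -> : (fun c => s P (row_of_tuple c)) =
    Num.sqrt \o (fun c : d.-tuple (measurableTypeR R) =>
      1 + eps ^+ 2 * \sum_i (P ord0 i - tnth c i) ^+ 2).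
  apply/funext => c; rewrite /s /multiquadric /enorm sqr_sqrtr ?dot_ge0//=.
  by congr (Num.sqrt (_ + _ * _)); apply: eq_bigr => i _; rewrite !mxE expr2.
apply: measurableT_comp; first exact: continuous_measurable_fun (@sqrt_continuous R).
apply: measurable_funD => //; apply: measurable_funM => //.
apply: measurable_sum => i; apply: measurable_funX.
by apply: measurable_funB => //; exact: measurable_tnth.
Qed.

Lemma measurable_kansa_row d alpha beta gamma (w P : 'rV[R]_d) : measurable_fun setT
  (fun c : d.-tuple (measurableTypeR R) =>
     kansa_row alpha beta gamma w P (row_of_tuple c)).
Proof.
have ms := measurable_multiquadric_row P.
apply: measurable_funM; last first.
  (* The inverse cube of a positive number is its real power of exponent -3, which is measurable. *)
  under eq_fun do rewrite -powR_invn ?ltW ?multiquadric_gt0//.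
  exact: (measurableT_comp (measurable_powR (1 *- 3)) ms).
apply: measurable_funD; last by apply: measurable_funM => //; exact: measurable_funX.
apply: measurable_funD => //; apply: measurable_funM; last exact: measurable_funX.
by apply: measurable_funD => //; exact: measurable_dot_row.
Qed.

(** * Restriction to lines parallel to the first coordinate axis *)

Section slice.
Context (n : nat).
Implicit Types (P w : 'rV[R]_n.+1) (t : n.-tuple R) (x : R).

Definition sqdist_tail P t := \sum_k (P ord0 (lift ord0 k) - tnth t k) ^+ 2.

(** This is [s^2 / eps^2] on the line; the division makes the quadratic monic. *)
Definition slice_quad P t : {poly R} :=
  ('X - (P ord0 ord0)%:P) ^+ 2 + (eps ^- 2 + sqdist_tail P t)%:P.

Definition dot_tail P w t :=
  \sum_k (P ord0 (lift ord0 k) - tnth t k) * w ord0 (lift ord0 k).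

Definition slice_affine beta w P t : {poly R} :=
  (beta + P ord0 ord0 * w ord0 ord0 + dot_tail P w t)%:P - w ord0 ord0 *: 'X.

Lemma slice_affineE beta w P t x : (slice_affine beta w P t).[x] =
  beta + dot (P - row_of_tuple (tcons (x, t))) w.
Proof.
rewrite /dot big_ord_recl !mxE /slice_affine !hornerE /dot_tail.
under [in RHS]eq_bigr do rewrite !mxE /tcons tnthS.
by rewrite /tcons/= tnth0; ring.
Qed.

Lemma slice_quadE P t x :
  s P (row_of_tuple (tcons (x, t))) = eps * Num.sqrt (slice_quad P t).[x].
Proof.
rewrite -[in RHS](gtr0_norm eps_gt0) -sqrtr_sqr -sqrtrM ?sqr_ge0//.
rewrite /s /multiquadric /enorm sqr_sqrtr ?dot_ge0//; congr Num.sqrt.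
rewrite /dot big_ord_recl !mxE /slice_quad !hornerE /sqdist_tail.
under [in LHS]eq_bigr do rewrite !mxE /tcons tnthS -expr2.
by rewrite /tcons/= tnth0; field; rewrite gt_eqF.
Qed.

Lemma slice_quad_const_gt0 P t : 0 < eps ^- 2 + sqdist_tail P t.
Proof.
by rewrite ltr_wpDr ?invr_gt0 ?exprn_gt0// sumr_ge0// => k _; exact: sqr_ge0.
Qed.

Lemma slice_quad_gt0 P t x : 0 < (slice_quad P t).[x].
Proof. by rewrite hornerD hornerC horner_exp ltr_wpDl ?slice_quad_const_gt0// sqr_ge0. Qed.

Definition slice_row alpha beta gamma w P t : {poly R} :=
  alpha%:P + slice_affine beta w P t * (eps ^+ 2 *: slice_quad P t)
  + gamma *: (eps ^+ 2 *: slice_quad P t) ^+ 2.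

(** As [s = eps sqrt q], the factor [1 / s^3] equals [sqrt q / (eps^3 q^2)]: the row is a rational
    function times one square root. *)
Lemma slice_rowE alpha beta gamma w P t x :
  kansa_row alpha beta gamma w P (row_of_tuple (tcons (x, t))) =
  (slice_row alpha beta gamma w P t).[x] * Num.sqrt (slice_quad P t).[x] /
    (eps ^+ 3 * (slice_quad P t).[x] ^+ 2).
Proof.
rewrite /kansa_row slice_quadE -slice_affineE /slice_row.
move: (slice_affine _ _ _ _) (slice_quad P t) (slice_quad_gt0 P t x) => m Q.
rewrite !(hornerD, hornerZ, hornerM, horner_exp, hornerC).
move: (m.[x]) (Q.[x]) => mx q q_gt0.
have r_gt0 : 0 < Num.sqrt q by rewrite sqrtr_gt0.
have := sqr_sqrtr (ltW q_gt0); move: (Num.sqrt q) r_gt0 => r r_gt0 <-.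
by field; rewrite !gt_eqF.
Qed.

(** By degrees: a nonzero [gamma] contributes degree 4, above the other terms; with [gamma = 0], a
    nonzero affine factor gives degree 2 or 3; failing both, the constant [alpha] remains. *)
Lemma slice_row_neq0 alpha beta gamma w P t :
    [\/ alpha != 0, gamma != 0 | slice_affine beta w P t != 0] ->
  slice_row alpha beta gamma w P t != 0.
Proof.
move=> nz; rewrite -size_poly_eq0 /slice_row.
set m := slice_affine _ _ _ _; set S := eps ^+ 2 *: _.
have szS : size S = 3.
  rewrite size_scale ?expf_neq0 ?gt_eqF// /slice_quad size_polyDl size_exp_XsubC//.
  by rewrite (leq_ltn_trans (size_polyC_leq1 _)).
have S0 : S != 0 by rewrite -size_poly_eq0 szS.
have szm : (size m <= 2)%N.
  rewrite (leq_trans (size_polyD _ _))// geq_max size_polyN.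
  rewrite (leq_trans (size_polyC_leq1 _))//=.
  by rewrite (leq_trans (size_scale_leq _ _))// size_polyX.
have szmS : m != 0 -> size (m * S) = (size m).+2.
  by move=> m0; rewrite size_mul// szS addn3.
have szmS4 : (size (m * S)%R <= 4)%N.
  by have [->|/szmS->] := eqVneq m 0; rewrite ?mul0r ?size_poly0.
have [g0|g0] := eqVneq gamma 0; last first.
  have szS2 : size (gamma *: S ^+ 2) = 5.
    by rewrite size_scale// expr2 size_mul// szS.
  rewrite addrC size_polyDl szS2// ltnS (leq_trans (size_polyD _ _))// geq_max szmS4.
  by rewrite (leq_trans (size_polyC_leq1 _)).
rewrite g0 scale0r addr0; have [m0|m0] := eqVneq m 0; last first.
  rewrite addrC size_polyDl szmS//.
  by rewrite (leq_ltn_trans (size_polyC_leq1 _)).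
case: nz; rewrite ?g0 ?eqxx// -/m ?m0 ?eqxx// mul0r addr0 => a0.
by rewrite size_poly_eq0 polyC_eq0.
Qed.

#[local] Instance ae_lebesgue_Rn_filter : Filter (almost_everywhere (lebesgue_Rn R n)).
Proof. exact: (ae_filter_ringOfSetsType (lebesgue_Rn R n)). Qed.

(** If the first coordinates differ, so do the quadratics. Otherwise they agree only when [t] is
    equidistant from the tails of [P] and [P'], that is, on the perpendicular bisector of two
    distinct points. *)
Lemma ae_slice_quad_neq P P' : P != P' ->
  {ae lebesgue_Rn R n, forall t, slice_quad P t != slice_quad P' t}.
Proof.
move=> PP'; have quad_eq t : slice_quad P t = slice_quad P' t ->
    P ord0 ord0 = P' ord0 ord0 /\ sqdist_tail P t = sqdist_tail P' t.
  rewrite /slice_quad; set a := P _ _; set a' := P' _ _ => qq.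
  have E x : (x - a) ^+ 2 + sqdist_tail P t = (x - a') ^+ 2 + sqdist_tail P' t.
    have := congr1 (fun q => q.[x]) qq.
    rewrite !(hornerXsubC, hornerC, horner_exp, hornerD).
    by rewrite addrCA [in RHS]addrCA => /addrI.
  have aa' : a = a' by have := E 0; have := E 1; lra.
  by split=> //; have := E 0; rewrite aa'; lra.
have [P0|P0] := eqVneq (P ord0 ord0) (P' ord0 ord0); last first.
  by apply: aeW => t; apply: contra_neq P0 => /quad_eq[].
pose u (k : 'I_n) := P ord0 (lift ord0 k) : R.
pose u' (k : 'I_n) := P' ord0 (lift ord0 k) : R.
(* Normal vector and offset of the bisector. *)
pose v k := 2 * (u k - u' k); pose c := \sum_k (u k ^+ 2 - u' k ^+ 2).
have v_neq0 : (exists k, v k != 0) \/ c != 0.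
  left; apply: contrapT => /forallNP v0; move/eqP: PP'; apply.
  apply/rowP => j; case: (unliftP ord0 j) => [k|] -> //.
  by apply/eqP; move/negP: (v0 k); rewrite negbK mulf_eq0 pnatr_eq0 subr_eq0.
have := ae_null (measurable_affine v c) (affine_null v_neq0).
apply: filterS => t /= tc; apply/eqP => /quad_eq[_ tt]; apply: tc.
apply/eqP; rewrite -subr_eq0 /c -sumrB; apply/eqP.
transitivity (sqdist_tail P' t - sqdist_tail P t); last by rewrite tt subrr.
by rewrite /sqdist_tail -sumrB; apply: eq_bigr => k _; rewrite /v -/(u k) -/(u' k); ring.
Qed.

(** The slope is [- w ord0 ord0]. If it is zero, the remaining constant is affine in [t] with
    nonzero linear part, so it vanishes only on a hyperplane. *)
Lemma ae_slice_affine_neq0 beta w P : w != 0 ->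
  {ae lebesgue_Rn R n, forall t, slice_affine beta w P t != 0}.
Proof.
move=> w_neq0; have affine_eq0 t : slice_affine beta w P t = 0 ->
    w ord0 ord0 = 0 /\ beta + dot_tail P w t = 0.
  move=> l0; have E x : (slice_affine beta w P t).[x] = 0 by rewrite l0 horner0.
  have := E 0; have := E 1; rewrite !hornerE => E1 E0.
  have w0 : w ord0 ord0 = 0 by lra.
  by split=> //; move: E0; rewrite w0; lra.
have [w0|w0] := eqVneq (w ord0 ord0) 0; last first.
  by apply: aeW => t; apply: contra_neq w0 => /affine_eq0[].
pose v (k : 'I_n) := w ord0 (lift ord0 k) : R.
pose c := beta + \sum_k P ord0 (lift ord0 k) * v k.
have v_neq0 : (exists k, v k != 0) \/ c != 0.
  left; apply: contrapT => /forallNP v0; move/eqP: w_neq0; apply.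
  apply/rowP => j; rewrite mxE; case: (unliftP ord0 j) => [k|] -> //.
  by apply/eqP; move/negP: (v0 k); rewrite negbK.
have := ae_null (measurable_affine v c) (affine_null v_neq0).
apply: filterS => t /= tc; apply/eqP => /affine_eq0[_ l0]; apply: tc.
apply/esym/eqP; rewrite -subr_eq0; apply/eqP.
rewrite -[RHS]l0 /c /dot_tail -addrA -sumrB.
by congr (_ + _); apply: eq_bigr => k _; rewrite /v; ring.
Qed.

Lemma kansa_rows_independent (I : finType) (P w : I -> 'rV[R]_n.+1)
    (alpha beta gamma a : I -> R) :
    injective P ->
    (forall i, [\/ alpha i != 0, gamma i != 0 | w i != 0]) ->
    (exists i, a i != 0) ->
  lebesgue_Rn R n.+1 [set c | \sum_i a i *
    kansa_row (alpha i) (beta i) (gamma i) (w i) (P i) (row_of_tuple c) = 0] = 0%E.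
Proof.
move=> P_inj nz a_neq0; apply: power_measure_cons_null.
  apply: measurable_zeros; apply: measurable_sum => i.
  by apply: measurable_funM => //; exact: measurable_kansa_row.
have ae_quad : {ae lebesgue_Rn R n, forall t, forall i j, i != j ->
    slice_quad (P i) t != slice_quad (P j) t}.
  apply: filter_forall => i; apply: filter_forall => j.
  have [->|ij] := eqVneq i j; first by apply: aeW => t; rewrite eqxx.
  apply: filterS (ae_slice_quad_neq (contra_neq (@P_inj i j) ij)).
  by move=> t quad_neq _.
have ae_affine : {ae lebesgue_Rn R n, forall t, forall i, w i != 0 ->
    slice_affine (beta i) (w i) (P i) t != 0}.
  apply: filter_forall => i; have [->|wi] := eqVneq (w i) 0.
    exact: aeW.
  by apply: filterS (ae_slice_affine_neq0 (beta i) (P i) wi) => t affine_neq0 _.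
apply: filterS2 ae_quad ae_affine => t quad_neq affine_neq0.
pose q i := slice_quad (P i) t.
have q_inj : injective q.
  by move=> i j qij; apply/eqP; apply: contraT => /quad_neq; rewrite -/(q i) qij eqxx.
have q_gt0 i x : 0 < (q i).[x] := slice_quad_gt0 (P i) t x.
pose r i := slice_row (alpha i) (beta i) (gamma i) (w i) (P i) t.
(* The coefficient of [sqrt (q i)] once the combination is multiplied by the common denominator
   [eps^3 \prod_j (q j)^2]. *)
pose p i := a i *: (r i * \prod_(j | j != i) q j ^+ 2).
have p_neq0 : exists i, p i != 0.
  have [i ai] := a_neq0; exists i; rewrite scaler_eq0 negb_or ai mulf_neq0//.
    apply: slice_row_neq0; have [?|?|/affine_neq0 ?] := nz i;
      by [constructor 1 | constructor 2 | constructor 3].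
  apply/prodf_neq0 => j _; rewrite expf_neq0//; apply/eqP => qj0.
  by have := q_gt0 j 0; rewrite qj0 horner0 ltxx.
have [l lP] : finite_zeros (fun x => \sum_i (p i).[x] * Num.sqrt (q i).[x]).
  apply: sqrt_sum_finite_zeros => // i.
  by apply: positive_irreducible_quad; exact: slice_quad_const_gt0.
apply/countable_lebesgue_measure0/finite_set_countable.
apply: (sub_finite_set _ (finite_seq l)) => x /= row0; apply: lP.
have := congr1 (fun z => eps ^+ 3 * \prod_j (q j).[x] ^+ 2 * z) row0.
rewrite mulr0 => {}row0; apply: etrans row0; rewrite mulr_sumr.
apply: eq_bigr => i _; rewrite slice_rowE -/(q i) -/(r i) (bigD1 i)//=.
rewrite /p hornerZ hornerM horner_prod.
under eq_bigr do rewrite horner_exp.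
have := q_gt0 i x; move: (\prod_(_ | _) _) => z.
by move: (q i).[x] => y y_gt0; field; rewrite !gt_eqF.
Qed.

End slice.
End kansa_rows.

(** * From Lebesgue-null sets to almost sure nonsingularity *)

Lemma density_null (dsp dsp' : measure_display) (T : measurableType dsp)
    (U : measurableType dsp') (R : realType) (Pr : probability T R)
    (mu : {measure set U -> \bar R}) (X : {RV Pr >-> U}) (sigma : U -> R)
    (A : set U) :
  has_density mu X sigma -> measurable A -> mu A = 0%E ->
  {ae Pr, forall w, ~ A (X w)}.
Proof.
move=> [/integrableP[sigma_meas _] _ XA] mA A0.
exists (X @^-1` A); split; last by move=> w /= /contrapT.
  by rewrite -[X in measurable X]setTI; exact: measurable_funP.
have := XA A mA; rewrite null_set_integral//.
exact: measurable_funS sigma_meas.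
Qed.

(** The tuple [c] packs [(alpha, beta, gamma, w)] and is chosen before the centers. Nondegeneracy
    comes from [eps^2] at internal points, from 1 on [G1], and from the unit length of [nu] on
    [G2]. *)
Lemma kansa_entry (R : realType) (d : nat) (Omega G1 G2 : set 'rV[R]_d)
    (v nu : 'rV[R]_d -> 'rV[R]_d) (eps : R) (NI N : nat) (P : 'I_N -> 'rV[R]_d) :
    0 < eps -> G1 `|` G2 = boundary Omega -> G1 `&` G2 = set0 ->
    (forall k : 'I_N, (NI <= k)%N -> boundary Omega (P k)) ->
    (forall k : 'I_N, (NI <= k)%N -> G2 (P k) ->
       unit_normal (boundary Omega) (P k) (nu (P k))) ->
  forall i, exists c : R * R * R * 'rV[R]_d,
    [\/ c.1.1.1 != 0, c.1.2 != 0 | c.2 != 0] /\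
    forall C : 'I_N -> 'rV[R]_d, forall j,
      kansa_matrix eps v G1 G2 nu NI P C i j =
      kansa_row eps c.1.1.1 c.1.1.2 c.1.2 c.2 (P i) (C j).
Proof.
move=> eps_gt0 G12 G1I2 P_boundary nu_normal i.
have e2 : eps ^+ 2 != 0 by rewrite expf_neq0// gt_eqF.
have dotZ P' C' w : dot (P' - C') (eps ^+ 2 *: w) = eps ^+ 2 * dot (P' - C') w.
  by rewrite /dot mulr_sumr; apply: eq_bigr => k _; rewrite !mxE; ring.
have dot0 P' C' : dot (P' - C') 0 = 0 :> R.
  by rewrite /dot big1// => k _; rewrite !mxE mulr0.
have [iNI|iNI] := ltnP i NI.
  exists (eps ^+ 2, eps ^+ 2 * (d%:R - 1), 0, eps ^+ 2 *: v (P i)).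
  split=> [|C j]; first by constructor 1.
  rewrite mxE iNI /convection_diffusion laplacian_multiquadric.
  rewrite dot_gradient_multiquadric /kansa_row dotZ /=.
  by field; rewrite gt_eqF ?multiquadric_gt0.
have := P_boundary i iNI; rewrite -G12 => -[G1i|G2i].
  exists (0, 0, 1, 0); split=> [|C j]; first by constructor 2; rewrite oner_neq0.
  have nG2i : ~ G2 (P i).
    by move=> G2i; have : (G1 `&` G2) (P i) by []; rewrite G1I2.
  rewrite mxE ltnNge iNI /mixed_boundary !indicE mem_set// memNset//= /kansa_row dot0.
  by field; rewrite gt_eqF ?multiquadric_gt0.
exists (0, 0, 0, eps ^+ 2 *: nu (P i)); split=> [|C j].
  constructor 3; rewrite scaler_eq0 negb_or e2/=.
  have [+ _] := nu_normal i iNI G2i.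
  apply: contra_eq_neq => ->.
  rewrite /enorm /dot big1 ?sqrtr0 1?eq_sym ?oner_neq0// => k _.
  by rewrite !mxE mulr0.
have nG1i : ~ G1 (P i).
  by move=> G1i; have : (G1 `&` G2) (P i) by []; rewrite G1I2.
rewrite mxE ltnNge iNI /mixed_boundary !indicE memNset// mem_set//=.
rewrite /normal_derivative dot_gradient_multiquadric /kansa_row dotZ.
by field; rewrite gt_eqF ?multiquadric_gt0.
Qed.

Theorem theorem1 (R : realType) (d : nat) (d_gt0 : (0 < d)%N)
    (Omega G1 G2 : set 'rV[R]_d)
    (Omega_open : open Omega) (Omega_connected : connected Omega)
    (Omega_bounded : bounded_set Omega)
    (G1UG2 : G1 `|` G2 = boundary Omega) (G1IG2 : G1 `&` G2 = set0)
    (v nu : 'rV[R]_d -> 'rV[R]_d) (eps : R) (eps_gt0 : 0 < eps)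
    (NI N : nat) (leNIN : (NI <= N)%N)
    (P : 'I_N -> 'rV[R]_d) (P_inj : injective P)
    (P_internal : forall i : 'I_N, (i < NI)%N -> Omega (P i))
    (P_boundary : forall k : 'I_N, (NI <= k)%N -> boundary Omega (P k))
    (nu_normal : forall k : 'I_N, (NI <= k)%N -> G2 (P k) ->
       unit_normal (boundary Omega) (P k) (nu (P k)))
    (dsp : measure_display) (T : measurableType dsp) (Pr : probability T R)
    (X : {RV Pr >-> N.-tuple (d.-tuple (measurableTypeR R))})
    (sigma : N.-tuple (d.-tuple (measurableTypeR R)) -> R)
    (X_density : has_density (lebesgue_RnN R d N) X sigma) :
  {ae Pr, forall w,
    \det (kansa_matrix eps v G1 G2 nu NI P
            (fun j => row_of_tuple (tnth (X w) j))) != 0}.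
Proof.
(* Positive dimension provides a first coordinate to slice along. *)
case: d d_gt0 => // n _ in Omega G1 G2 Omega_open Omega_connected Omega_bounded G1UG2
  G1IG2 v nu P P_inj P_internal P_boundary nu_normal X sigma X_density *.
have [c /all_and2[c_neq0 entryE]] :=
  choice (kansa_entry v eps_gt0 G1UG2 G1IG2 P_boundary nu_normal).
pose F i (x : n.+1.-tuple (measurableTypeR R)) : R :=
  kansa_row eps (c i).1.1.1 (c i).1.1.2 (c i).1.2 (c i).2 (P i) (row_of_tuple x).
have mF i : measurable_fun setT (F i) by exact: measurable_kansa_row.
pose A := [set t : N.-tuple (n.+1.-tuple (measurableTypeR R)) |
  \det (\matrix_(i < N, j < N) F i (tnth t j)) = 0].
have mA : measurable A by exact: measurable_zeros (measurable_det mF).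
have A0 : lebesgue_RnN R n.+1 N A = 0%E.
  apply: det_collocation_null => // a a_neq0.
  by apply: kansa_rows_independent.
apply: filterS (density_null X_density mA A0) => w Aw.
apply/eqP => det0; apply: Aw; rewrite /A /= -[RHS]det0; congr (\det _).
by apply/matrixP => i j; rewrite entryE mxE.
Qed.
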